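(* Let $(C,\phi)$ be an $n$-component semicoherent system with continuous and i.i.d. component lifetimes, with tail signature $(\overline{S}_0,\ldots,\overline{S}_n)$ and domination coefficients $d_0,\ldots,d_n$. Then $$\overline{S}_k = \sum_{j=0}^{n-k}\frac{\binom{n-j}{k}}{\binom{n}{k}}\, d_j = \sum_{j=0}^{n-k}\frac{\binom{n-k}{j}}{\binom{n}{j}}\, d_j,\qquad k=0,\ldots,n,$$ $$d_k = \binom{n}{k}\sum_{j=0}^k(-1)^{k-j}\binom{k}{j}\,\overline{S}_{n-j},\qquad k=0,\ldots,n.$$
   Context: $n\ge 1$, $C=[n]=\{1,\ldots,n\}$ is the set of components, and $\phi\colon\{0,1\}^n\to\{0,1\}$ is the structure function. The system is semicoherent: $\phi$ is nondecreasing in each variable, $\phi(0,\ldots,0)=0$ and $\phi(1,\ldots,1)=1$. Boolean vectors $\mathbf{x}\in\{0,1\}^n$ are identified with subsets $A\subseteq C$ by $x_i=1$ iff $i\in A$, so one writes $\phi(A)$. The components have continuous i.i.d. lifetimes $T_1,\ldots,T_n$; $T_{k:n}$ is the $k$-th smallest lifetime and $T_S$ is the system lifetime, i.e. the time at which the system fails, $T_S=\max_{A:\phi(A)=1}\min_{i\in A}T_i$. The signature is $\mathbf{s}=(s_1,\ldots,s_n)$ with $s_k=\Pr(T_S=T_{k:n})$, and the tail signature is $(\overline{S}_0,\ldots,\overline{S}_n)$ with $\overline{S}_k=\sum_{i=k+1}^n s_i$. The reliability function is the multilinear polynomial function $h(x_1,\ldots,x_n)=\sum_{A\subseteq C}\phi(A)\prod_{i\in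 A}x_i\prod_{i\in C\setminus A}(1-x_i)$ on $[0,1]^n$; its diagonal section is the univariate polynomial $h(x)=h(x,\ldots,x)$, of degree at most $n$, and $d_k$ is the coefficient of $x^k$ in $h(x)$, so $h(x)=\sum_{k=0}^n d_kx^k$. *)

(* Defs.v *)
From HB Require Import structures.
From mathcomp Require Export all_boot all_order all_algebra.
From mathcomp Require Export all_classical all_reals all_analysis.
Export Order.TTheory GRing.Theory Num.Theory.
Export numFieldNormedType.Exports.

Set Implicit Arguments.
Unset Strict Implicit.
Unset Printing Implicit Defensive.

Local Open Scope classical_set_scope.
Local Open Scope ring_scope.

(* The component i of {1, ..., n} is the element i - 1 of 'I_n. *)
Definition setvec n (A : {set 'I_n}) : {ffun 'I_n -> bool} :=
  [ffun i => i \in A].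

Definition semicoherent n (phi : {ffun 'I_n -> bool} -> bool) : Prop :=
  [/\ forall (i : 'I_n) (x y : {ffun 'I_n -> bool}),
        (forall j, j != i -> x j = y j) -> x i ==> y i -> phi x ==> phi y,
      phi [ffun=> false] = false
    & phi [ffun=> true] = true].

Section Lifetimes.
Context d (Omega : measurableType d) (R : realType) (P : probability Omega R).
Context (n : nat) (T : 'I_n -> {RV P >-> R}).

Definition mutually_independent : Prop :=
  forall (J : {set 'I_n}) (B : 'I_n -> set R),
    (forall i, measurable (B i)) ->
    P [set w | forall i, i \in J -> B i (T i w)] =
      (\prod_(i in J) P (T i @^-1` B i))%E.

Definition identically_distributed : Prop :=
  forall (i j : 'I_n) (B : set R), measurable B ->
    distribution P (T i) B = distribution P (T j) B.

Definition continuous_lifetimes : Prop :=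
  forall i : 'I_n, continuous (cdf (T i)).

Definition continuous_iid : Prop :=
  [/\ mutually_independent, identically_distributed & continuous_lifetimes].

(* T_{k:n}, for 1 <= k <= n *)
Definition order_stat (k : nat) (w : Omega) : R :=
  nth 0 (sort <=%R [seq T i w | i <- enum 'I_n]) k.-1.

Variable phi : {ffun 'I_n -> bool} -> bool.

(* -oo and +oo are the neutral elements of max and min; they do not survive
   when phi is semicoherent, since then some A satisfies phi A and no such A
   is empty. *)
Definition system_lifetime (w : Omega) : \bar R :=
  (\big[maxe/-oo]_(A : {set 'I_n} | phi (setvec A))
     \big[mine/+oo]_(i in A) (T i w)%:E)%E.

Definition signature (k : nat) : R :=
  fine (P [set w | system_lifetime w = (order_stat k w)%:E]).

Definition tail_signature (k : nat) : R :=
  \sum_(k.+1 <= i < n.+1) signature i.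

End Lifetimes.

(* Over a commutative ring A, so that it can be evaluated at real numbers and
   at the indeterminate. *)
Definition reliability (A : comNzRingType) n
    (phi : {ffun 'I_n -> bool} -> bool) (x : 'I_n -> A) : A :=
  \sum_(S : {set 'I_n}) (phi (setvec S))%:R *
    (\prod_(i in S) x i) * \prod_(i in ~: S) (1 - x i).

Definition diag_reliability (R : comNzRingType) n
    (phi : {ffun 'I_n -> bool} -> bool) : {poly R} :=
  reliability phi (fun=> 'X).

Lemma diag_reliabilityE (R : comNzRingType) n
    (phi : {ffun 'I_n -> bool} -> bool) (x : R) :
  (diag_reliability R phi).[x] = reliability phi (fun=> x).
Proof.
rewrite /diag_reliability /reliability horner_sum; apply: eq_bigr => S _.
by rewrite !hornerM !horner_prod; congr (_ * _ * _);
  [rewrite -polyC_natr hornerC | apply: eq_bigr => i _; rewrite hornerX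
  | apply: eq_bigr => i _; rewrite !hornerE].
Qed.

Definition domination (R : comNzRingType) n
    (phi : {ffun 'I_n -> bool} -> bool) (k : nat) : R :=
  (diag_reliability R phi)`_k.

(* Main.v *)
From HB Require Import structures.
Require Import Defs.
From mathcomp Require Import zify perm measurable_realfun.

(** Both formulas express one relation between the domination coefficients and
the averages of [phi] over the subsets of a given size,
[[
  a_m = (\sum_(#|A| = m) phi A) / 'C(n, m),
]]
because the tail signature consists of these averages: the value at [k] is
[a_(n - k)].

The probabilistic half is this last equality
([tail_signature_size_average]).  Everything about the lifetimes that matters is
their rank vector, which sends [i] to the number of lifetimes below that of
[i].  Independent lifetimes without atoms are almost surely distinct, so the
rank vector is almost surely injective ([rank_law_noninj]); permuting i.i.d.
lifetimes does not change their joint law, so neither does it change the law of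
the rank vector ([rank_law_exch]).  When the lifetimes are distinct, the system
fails at the [k]-th failure exactly when the components of rank at least
[k - 1] form a working set and those of rank at least [k] do not, so summing
over the failures after the [k]-th telescopes to the probability that the
components of rank at least [k] form a working set.  That random set has
[n - k] elements and, by symmetry, is equally likely to be any such subset
([sum_rank_law_upper_set]): the probability is [a_(n - k)].

The algebraic half starts from
[h = \sum_m a_m * 'C(n, m) * X^m * (1 - X)^(n - m)].  Expanding the powers of
[1 - X] gives [d_k] as ['C(n, k)] times the [k]-th finite difference of [a]
([domination_size_average]), which is the second formula.  The first one is the
binomial inversion of the second ([size_average_domination]), up to the identity
between quotients of binomials in [bin_ratio_swap]. *)

Set Implicit Arguments.
Unset Strict Implicit.
Unset Printing Implicit Defensive.

Local Open Scope ring_scope.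

(** * Domination coefficients and averages over subsets of a given size *)

Definition size_average (R : fieldType) n
    (phi : {ffun 'I_n -> bool} -> bool) (m : nat) : R :=
  (\sum_(A : {set 'I_n} | #|A| == m) (phi (setvec A))%:R) / 'C(n, m)%:R.

Lemma coef_sub1X_exp (R : comNzRingType) N i :
  ((1 - 'X : {poly R}) ^+ N)`_i = (-1) ^+ i * 'C(N, i)%:R.
Proof.
suff -> : (1 - 'X : {poly R}) ^+ N =
    \poly_(l < N.+1) ((-1) ^+ l * 'C(N, l)%:R).
  by rewrite coef_poly ltnS; case: leqP => // lt; rewrite bin_small // mulr0.
rewrite poly_def exprBn; apply: eq_bigr => l _.
rewrite expr1n mulr1 mulr_natr -mul_polyC.
by rewrite rmorphMn rmorphXn rmorphN1 mulrnAl.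
Qed.

Lemma coef_subX1_exp (R : comNzRingType) j i :
  (('X - 1 : {poly R}) ^+ j)`_i = (-1) ^+ (j - i) * 'C(j, i)%:R.
Proof.
have -> : ('X - 1 : {poly R}) = (-1)%:P * (1 - 'X).
  by rewrite rmorphN1 mulN1r opprB.
rewrite exprMn -rmorphXn coefCM coef_sub1X_exp.
case: (leqP i j) => [le_ij|lt]; last by rewrite bin_small // !mulr0.
by rewrite mulrA -exprD -signr_odd oddB // -oddD signr_odd.
Qed.

(** Both sides count the chains of a set of size [m] inside one of size [j]
inside one of size [n]. *)
Lemma bin_mul_sub n j m : (m <= j)%N -> (j <= n)%N ->
  ('C(n, m) * 'C(n - m, j - m) = 'C(n, j) * 'C(j, m))%N.
Proof.
move=> mj jn; have mn := leq_trans mj jn.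
have jmn : (j - m <= n - m)%N by rewrite leq_sub2r.
have := bin_fact jmn; rewrite subnBA // subnK // => e1.
have f0 : (0 < m`! * (j - m)`! * (n - j)`!)%N by rewrite !muln_gt0 !fact_gt0.
apply/eqP; rewrite -(eqn_pmul2r f0); apply/eqP; transitivity n`!.
  by rewrite -(bin_fact mn) -e1; lia.
by rewrite -(bin_fact jn) -(bin_fact mj); lia.
Qed.

(** Cross-multiplied, both sides count the pairs of disjoint subsets of sizes
[k] and [j]; each product equals ['C(n, j + k)] times ['C(j + k, j)]. *)
Lemma bin_ratio_swap (R : numFieldType) n k j : (k <= n)%N -> (j <= n - k)%N ->
  'C(n - j, k)%:R / 'C(n, k)%:R = 'C(n - k, j)%:R / 'C(n, j)%:R :> R.
Proof.
move=> kn jnk.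
have jn : (j <= n)%N := leq_trans jnk (leq_subr _ _).
have jkn : (j + k <= n)%N by rewrite addnC -leq_subRL.
apply/eqP; rewrite eqr_div ?pnatr_eq0 -?lt0n ?bin_gt0 // -!natrM; apply/eqP.
congr (_%:R).
have := bin_mul_sub (leq_addr k j) jkn; have := bin_mul_sub (leq_addl j k) jkn.
rewrite addKn addnK => e1 e2.
by rewrite mulnC e2 mulnC [RHS]mulnC e1 -(bin_sub (leq_addr k j)) addKn mulnC.
Qed.

Section Diagonal.
Variables (R : numFieldType) (n : nat) (phi : {ffun 'I_n -> bool} -> bool).
Local Notation a := (size_average R phi).

(** On the diagonal the term of [A] in the reliability function depends on [A]
only through [phi A] and [#|A|], so the terms can be grouped by size. *)
Lemma diag_reliability_size_average :
  diag_reliability R phi =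
    \sum_(m < n.+1) (a m * 'C(n, m)%:R) *: ('X^m * (1 - 'X) ^+ (n - m)).
Proof.
rewrite /diag_reliability /reliability.
under eq_bigr => A _ do
  rewrite !prodr_const [#|~: A|]cardsCs finset.setCK card_ord -mulrA.
rewrite (partition_big (fun A : {set 'I_n} => inord #|A| : 'I_n.+1) xpredT) //=.
apply: eq_bigr => m _; have mn : (m <= n)%N by rewrite -ltnS.
rewrite divfK ?pnatr_eq0 -?lt0n ?bin_gt0 // scaler_suml.
apply: eq_big => [A|A /eqP <-].
  by rewrite -val_eqE /= inordK // ltnS -[X in (_ <= X)%N]card_ord max_card.
have lt : (#|A| < n.+1)%N by rewrite ltnS -[X in (_ <= X)%N]card_ord max_card.
by rewrite /= inordK // scaler_nat mulr_natl.
Qed.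

(** The sum is the [k]-th finite difference at 0 of the averages.  The term of
size [m] of the diagonal contributes through the coefficient of [X^(k - m)] in
[(1 - X)^(n - m)], and ['C(n, k)] factors out by [bin_mul_sub]. *)
Lemma domination_size_average k : (k <= n)%N ->
  domination R phi k =
    'C(n, k)%:R * \sum_(0 <= j < k.+1) (-1) ^+ (k - j) * 'C(k, j)%:R * a j.
Proof.
move=> kn; rewrite /domination diag_reliability_size_average coef_sum.
under eq_bigr => m _ do rewrite coefZ coefXnM coef_sub1X_exp.
rewrite -(big_mkord xpredT (fun m => a m * 'C(n, m)%:R *
  (if (k < m)%N then 0 else (-1) ^+ (k - m) * 'C(n - m, k - m)%:R))).
rewrite (big_cat_nat (n := k.+1)) //= [X in _ + X]big_nat_cond
  [X in _ + X]big1 ?addr0; last first.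
  by move=> i /andP[/andP[-> _] _]; rewrite mulr0.
rewrite mulr_sumr; apply: eq_big_nat => m; rewrite ltnS => /= mk.
rewrite ltnNge mk /= mulrCA -!mulrA [RHS]mulrCA; congr (_ * _).
by rewrite mulrA [in RHS]mulrA -!natrM mulrC bin_mul_sub.
Qed.

(** Binomial inversion, done umbrally: if the linear form [L] sends ['X^i] to
[a i], then by [domination_size_average] it sends [('X - 1) ^+ j] to
[d_j / 'C(n, j)].  Applying [L] to the binomial expansion of
[('X - 1 + 1) ^+ m = 'X^m] gives the formula. *)
Lemma size_average_domination m : (m <= n)%N ->
  a m = \sum_(0 <= j < m.+1) 'C(m, j)%:R / 'C(n, j)%:R * domination R phi j.
Proof.
move=> mn; pose L (q : {poly R}) := \sum_(i < n.+1) q`_i * a i.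
have LD : {morph L : p q / p + q}.
  by move=> p q; rewrite /L -big_split; apply: eq_bigr => i _; rewrite coefD mulrDl.
have L0 : L 0 = 0 by rewrite /L big1 // => i _; rewrite coef0 mul0r.
have -> : a m = L (('X - 1 + 1) ^+ m).
  rewrite subrK /L (bigD1 (inord m)) //= inordK // coefXn eqxx mul1r big1 ?addr0 //.
  move=> i ne; rewrite coefXn (_ : (i == m :> nat) = false) ?mul0r //.
  by apply: contraNF ne => /eqP e; apply/eqP/val_inj; rewrite /= inordK.
rewrite addrC exprDn (big_morph L LD L0) big_mkord; apply: eq_bigr => j _.
have jm : (j <= m)%N by rewrite -ltnS.
have jn := leq_trans jm mn.
rewrite domination_size_average // mulrA divfK ?pnatr_eq0 -?lt0n ?bin_gt0 //.
rewrite expr1n mul1r /L mulr_sumr.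
rewrite -(big_mkord xpredT (fun i => (('X - 1) ^+ j *+ 'C(m, j))`_i * a i)).
rewrite (big_cat_nat (n := j.+1)) //= [X in _ + X]big_nat_cond
  [X in _ + X]big1 ?addr0.
  by apply: eq_bigr => i _; rewrite coefMn coef_subX1_exp -[_ *+ _]mulr_natl !mulrA.
move=> i /andP[/andP[ji _] _].
by rewrite coefMn coef_subX1_exp bin_small // mulr0 mul0rn mul0r.
Qed.
End Diagonal.

(** * Exchangeable random rank vectors *)

(** Monotonicity one coordinate at a time extends to inclusions by adding the
elements of [B :\: A] to [A] one by one. *)
Lemma semicoherent_mono n (phi : {ffun 'I_n -> bool} -> bool) :
  semicoherent phi ->
  forall A B : {set 'I_n}, A \subset B -> phi (setvec A) ==> phi (setvec B).
Proof.
move=> [mono _ _] A B; move: {2}#|B :\: A| (erefl #|B :\: A|) => c.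
elim: c A => [|c IH] A hc sAB.
  have -> : A = B; last exact: implybb.
  by apply/eqP; rewrite finset.eqEsubset sAB -finset.setD_eq0 -finset.cards_eq0 hc.
have [i iBA] : exists i, i \in B :\: A.
  by apply/finset.set0Pn; rewrite -finset.cards_eq0 hc.
have /finset.setDP[iB iA] := iBA.
have hAi : phi (setvec A) ==> phi (setvec (i |: A)).
  apply: (mono i) => [j ji|]; rewrite !ffunE !inE ?eqxx ?implybT //.
  by rewrite (negPf ji).
have hAiB : phi (setvec (i |: A)) ==> phi (setvec B).
  apply: IH; last by rewrite finset.subUset finset.sub1set iB.
  by move: hc; rewrite (cardsD1 i) iBA => -[<-]; rewrite finset.setUC finset.setDDl.
by apply/implyP => /(implyP hAi) /(implyP hAiB).
Qed.

(** Two subsets of the same size have indicator sequences with the same numbers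
of [true] and [false], and such sequences are permutations of each other. *)
Lemma perm_card_eq n (A B : {set 'I_n}) :
  #|A| = #|B| -> exists s : 'S_n, forall i, (i \in A) = (s i \in B).
Proof.
move=> AB.
have cnt (b : pred bool) (t : seq bool) :
    count b t = (b true * count id t + b false * (size t - count id t))%N.
  rewrite -(count_predC id t) addKn; elim: t => [|x t /= ->]; first by rewrite !muln0.
  by case: x; rewrite /= !mulnDr !muln1 !muln0 ?add0n -?addnA // addnCA.
have cntC (C : {set 'I_n}) : count id [tuple i \in C | i < n] = #|C|.
  by rewrite /= count_map -size_filter cardE enumT; congr (size _); apply: eq_filter.
have /tuple_permP[s e] :
    perm_eq [tuple i \in A | i < n] [tuple i \in B | i < n].
  by apply/seq.permP => b; rewrite cnt [RHS]cnt !cntC !size_tuple AB.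
exists s => i; have /(congr1 (fun t => tnth t i)) := val_inj e.
by rewrite !tnth_mktuple.
Qed.

Definition upper_set n (f : {ffun 'I_n -> 'I_n}) (k : nat) : {set 'I_n} :=
  [set i | (k <= f i)%N].

Lemma card_lower n (f : {ffun 'I_n -> 'I_n}) m : injective f -> (m <= n)%N ->
  #|[set i | (f i < m)%N]| = m.
Proof.
move=> fi mn.
have wi : injective (widen_ord mn) by move=> i j [] /val_inj.
rewrite -[RHS](card_ord m) -(card_imset _ wi).
rewrite -(card_imset _ fi) /=; apply: eq_card => x.
apply/imsetP/imsetP => [[i]|[y _ ->]].
  by rewrite inE => lt ->; exists (Ordinal lt) => //; apply: val_inj.
have [g gK fK] := injF_bij fi.
by exists (g (widen_ord mn y)); rewrite ?inE fK //= ltn_ord.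
Qed.

Lemma card_upper_set n (f : {ffun 'I_n -> 'I_n}) k : injective f -> (k <= n)%N ->
  #|upper_set f k| = (n - k)%N.
Proof.
move=> fi kn; rewrite -[in RHS](card_lower fi kn) cardsCs card_ord.
by congr (_ - _)%N; apply: eq_card => i; rewrite !inE -ltnNge.
Qed.

Section RankLaw.
Variables (R : numFieldType) (n : nat) (p : {ffun 'I_n -> 'I_n} -> R).
Hypothesis p_sum1 : \sum_(f : {ffun 'I_n -> 'I_n}) p f = 1.
Hypothesis p_noninj : forall f : {ffun 'I_n -> 'I_n}, ~~ injectiveb f -> p f = 0.
Hypothesis p_exch : forall (f : {ffun 'I_n -> 'I_n}) (s : 'S_n),
  p [ffun i => f (s i)] = p f.

(** Under [p] the random set [upper_set f k] almost surely has [n - k] elements,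
as [f] is almost surely a bijection, and by exchangeability all the subsets of
that size are equally likely; so the expectation of [phi] on it is the plain
average over them. *)
Lemma sum_rank_law_upper_set k (phi : {ffun 'I_n -> bool} -> bool) :
  (k <= n)%N ->
  \sum_f p f * (phi (setvec (upper_set f k)))%:R = size_average R phi (n - k).
Proof.
move=> kn; pose v (A : {set 'I_n}) := \sum_(f | upper_set f k == A) p f.
have v_card (A : {set 'I_n}) : #|A| != (n - k)%N -> v A = 0.
  move=> cA; apply: big1 => f /eqP fA; apply: p_noninj; apply: contra cA.
  by move=> /injectiveP fi; rewrite -fA card_upper_set.
have v_eq (A B : {set 'I_n}) : #|A| = #|B| -> v A = v B.
  move=> /perm_card_eq[s sE]; rewrite /v.
  pose h (f : {ffun 'I_n -> 'I_n}) : {ffun 'I_n -> 'I_n} := [ffun i => f (s i)].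
  have hbij : bijective h.
    exists (fun f : {ffun 'I_n -> 'I_n} =>
      [ffun i => f (s^-1%g i)] : {ffun 'I_n -> 'I_n}).
      by move=> f; apply/ffunP => i; rewrite !ffunE permKV.
    by move=> f; apply/ffunP => i; rewrite !ffunE permK.
  rewrite (reindex h) /=; last exact: onW_bij.
  apply: eq_big => [f|f _]; last exact: p_exch.
  apply/eqP/eqP => [e|e].
    apply/setP => j; rewrite -(permKV s j) -sE -e.
    by rewrite !inE !ffunE.
  by apply/setP => i; rewrite sE -e !inE !ffunE.
have v_sum : \sum_A v A = 1.
  by rewrite -p_sum1 (partition_big (fun f => upper_set f k) xpredT).
have vE (A : {set 'I_n}) : #|A| = (n - k)%N -> v A = 'C(n, n - k)%:R^-1.
  move=> cA; have C0 : 'C(n, n - k)%:R != 0 :> R.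
    by rewrite pnatr_eq0 -lt0n bin_gt0 leq_subr.
  apply: (mulfI C0); rewrite divff //.
  transitivity (\sum_B v B); last exact: v_sum.
  rewrite (bigID (fun B : {set 'I_n} => #|B| == (n - k)%N)) /=.
  rewrite [X in _ + X]big1 ?addr0; last by move=> B; exact: v_card.
  rewrite (eq_bigr (fun=> v A)); last by move=> B /eqP cB; apply: v_eq; rewrite cB.
  rewrite sumr_const mulr_natl; congr (_ *+ _).
  rewrite -[X in 'C(X, _)](card_ord n) -card_draws.
  by apply: eq_card => B; rewrite !inE.
rewrite (partition_big (fun f => upper_set f k) xpredT) //= /size_average.
rewrite (bigID (fun B : {set 'I_n} => #|B| == (n - k)%N)) /=.
have sumv A : \sum_(f | upper_set f k == A) p f * (phi (setvec (upper_set f k)))%:R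
    = v A * (phi (setvec A))%:R.
  by rewrite /v mulr_suml; apply: eq_bigr => f /eqP ->.
rewrite [X in _ + X]big1 ?addr0; last first.
  by move=> A /v_card vA; rewrite sumv vA mul0r.
by rewrite mulr_suml; apply: eq_bigr => A /eqP cA; rewrite sumv vE // mulrC.
Qed.
End RankLaw.

(** * System failure in terms of ranks *)

Section Rank.
Variables (R : realType) (n : nat).
Implicit Types (t : 'I_n -> R) (i j : 'I_n).

Lemma rank_ltn t i : (#|[set j | (t j < t i)%R]| < n)%N.
Proof.
rewrite -[X in (_ < X)%N](card_ord n) -cardsT; apply: proper_card.
by apply/properP; split; [exact: finset.subsetT|exists i; rewrite !inE ?ltxx].
Qed.

(** Ties are allowed: tied components share the number of strictly smaller
entries, so that ranks determine all the comparisons between entries, and [t] is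
injective exactly when its rank vector is. *)
Definition rank t : {ffun 'I_n -> 'I_n} := [ffun i => Ordinal (rank_ltn t i)].

Lemma ltn_rank t i j : (rank t i < rank t j)%N = (t i < t j).
Proof.
rewrite !ffunE /=; apply/idP/idP => [|ij].
  apply: contraTT; rewrite -leNgt -leqNgt => ji; apply: subset_leq_card.
  by apply/fintype.subsetP => l; rewrite !inE => /lt_le_trans; exact.
apply: proper_card; apply/properP; split.
  by apply/fintype.subsetP => l; rewrite !inE => /lt_trans; exact.
by exists i; rewrite !inE ?ij ?ltxx.
Qed.

Lemma leq_rank t i j : (rank t i <= rank t j)%N = (t i <= t j).
Proof. by rewrite leqNgt ltn_rank -leNgt. Qed.

Lemma rank_perm t (s : 'S_n) : rank (t \o s) = [ffun i => rank t (s i)].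
Proof.
apply/ffunP => i; rewrite !ffunE; apply/val_inj => /=.
rewrite -(card_imset _ (@perm_inj _ s)); apply: eq_card => j.
apply/imsetP/idP => [[l]|]; first by rewrite !inE => h ->.
by rewrite inE => h; exists ((s^-1)%g j); rewrite ?inE /= permKV.
Qed.

Variable phi : {ffun 'I_n -> bool} -> bool.
Hypothesis hphi : semicoherent phi.

(** A working set all of whose components last until [x] is contained in the set
of all the components that do, so by monotonicity one may test the latter. *)
Lemma le_lifetime t (x : R) :
  (x%:E <= \big[maxe/-oo]_(A : {set 'I_n} | phi (setvec A))
     \big[mine/+oo]_(i in A) (t i)%:E)%E = phi (setvec [set i | x <= t i]).
Proof.
apply/idP/idP => [|h].
  apply: contraTT => h; rewrite -ltNge; apply/bigmax_ltP.
  split; first exact: ltNyr.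
  move=> A pA; rewrite ltNge; apply: contra h => /bigmin_geP[_ hA].
  apply: (implyP (semicoherent_mono hphi _) pA).
  by apply/fintype.subsetP => i /hA; rewrite inE lee_fin.
apply: (bigmax_sup [set i | x <= t i]%SET) => //.
apply/bigmin_geP; split; first exact: leey.
by move=> i; rewrite inE lee_fin.
Qed.

Lemma lt_lifetime t (x : R) :
  (x%:E < \big[maxe/-oo]_(A : {set 'I_n} | phi (setvec A))
     \big[mine/+oo]_(i in A) (t i)%:E)%E = phi (setvec [set i | x < t i]).
Proof.
apply/idP/idP => [|h].
  apply: contraTT => h; rewrite -leNgt; apply/bigmax_leP.
  split; first exact: leNye.
  move=> A pA; rewrite leNgt; apply: contra h => /bigmin_gtP[_ hA].
  apply: (implyP (semicoherent_mono hphi _) pA).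
  by apply/fintype.subsetP => i /hA; rewrite inE lte_fin.
apply: lt_le_trans (le_bigmax_cond (j := [set i | x < t i]%SET) _ _ _) => //.
apply/bigmin_gtP; split; first exact: ltry.
by move=> i; rewrite inE lte_fin.
Qed.

(** The component [c] realizes the [k]-th smallest lifetime, tied components
included; the system works with the components alive just before that time and
no longer with those alive after it. *)
Definition failure_at (f : {ffun 'I_n -> 'I_n}) (k : nat) : bool :=
  [exists c, [&& (f c < k <= #|[set j | f j <= f c]|)%N,
    phi (setvec (upper_set f (f c))) & ~~ phi (setvec (upper_set f (f c).+1))]].

Lemma count_image_enum t (q : pred R) :
  count q [seq t i | i <- enum 'I_n] = #|[set j | q (t j)]|.
Proof.
rewrite count_map -size_filter cardE enumT; congr size.
by apply: eq_filter => i; rewrite !inE.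
Qed.

(** The equivalence covers vectors with ties, so that the event defining
[signature] is a function of the rank vector everywhere and thereby
measurable. *)
Lemma failure_atP t k : (1 <= k <= n)%N ->
  ((\big[maxe/-oo]_(A : {set 'I_n} | phi (setvec A))
     \big[mine/+oo]_(i in A) (t i)%:E)%E =
    (nth 0 (sort <=%R [seq t i | i <- enum 'I_n]) k.-1)%:E) <->
  failure_at (rank t) k.
Proof.
move=> /andP[k1 kn]; set s := [seq t i | i <- enum 'I_n]; set L := (X in X = _).
have ss : sorted <=%R (sort <=%R s) by exact: sort_le_sorted.
have cnt q : count q (sort <=%R s) = #|[set j | q (t j)]|.
  by rewrite -count_image_enum; apply/seq.permP; rewrite perm_sort.
have LE c : (L == (t c)%:E) = phi (setvec (upper_set (rank t) (rank t c))) &&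
    ~~ phi (setvec (upper_set (rank t) (rank t c).+1)).
  rewrite eq_le andbC le_lifetime leNgt lt_lifetime.
  congr (phi (setvec _) && ~~ phi (setvec _)).
    by apply/setP => j; rewrite !inE leq_rank.
  by apply/setP => j; rewrite !inE ltn_rank.
have nthE c : ((rank t c < k <= #|[set j | (rank t j <= rank t c)%N]|)%N) ->
    nth 0 (sort <=%R s) k.-1 = t c.
  move=> /andP[h1 h2]; apply: nth_count_eq => //; rewrite !cnt -ltnS prednK //.
  apply/andP; split; first by move: h1; rewrite ffunE.
  by move: h2; congr (_ <= _)%N; apply: eq_card => j; rewrite !inE leq_rank.
split=> [e|/existsP[c /and3P[hc h1 h2]]]; last first.
  by apply/eqP; rewrite (nthE c hc) LE h1.
have k1s : (k.-1 < size (sort <=%R s))%N.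
  by rewrite size_sort size_map size_enum_ord prednK.
have : nth 0 (sort <=%R s) k.-1 \in s by rewrite -(mem_sort <=%R) mem_nth.
move=> /mapP[c _ ec]; apply/existsP; exists c.
move/eqP: e; rewrite ec LE => ->; rewrite andbT; apply/andP; split.
  rewrite ltnNge; apply/negP; rewrite ffunE /= -(cnt (fun x => x < t c)) => h.
  have := nth_count_lt 0 ss (x := t c) (i := k.-1).
  by rewrite ec ltxx prednK // => /(_ h).
rewrite leqNgt; apply/negP => h.
have := nth_count_gt (x := t c) 0 (i := k.-1) ss.
rewrite ec ltxx k1s andbT cnt -ltnS prednK // => H.
suff : false by []; apply: H; apply: leq_trans h; rewrite ltnS.
by apply: eq_leq; apply: eq_card => j; rewrite !inE leq_rank.
Qed.

(** Without ties the component realizing the [k]-th smallest lifetime is the one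
of rank [k.-1]. *)
Lemma failure_at_inj (f : {ffun 'I_n -> 'I_n}) k :
  injective f -> (1 <= k <= n)%N ->
  failure_at f k =
    phi (setvec (upper_set f k.-1)) && ~~ phi (setvec (upper_set f k)).
Proof.
move=> fi /andP[k1 kn].
have fE c : (f c < k <= #|[set j | f j <= f c]|)%N = (f c == k.-1 :> nat).
  have -> : #|[set j | (f j <= f c)%N]| = (f c).+1.
    by rewrite -[RHS](card_lower fi (ltn_ord (f c))).
  by rewrite -eqn_leq -[in LHS](prednK k1) eqSS.
apply/existsP/andP => [[c /and3P[]]|[h1 h2]].
  by rewrite fE => /eqP ->; rewrite prednK.
have [g _ fK] := injF_bij fi.
have lt : (k.-1 < n)%N by rewrite prednK.
by exists (g (Ordinal lt)); rewrite fE fK /= eqxx prednK // h1.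
Qed.
End Rank.

(** * Finite-valued functions of the lifetimes *)

Section FiniteValued.
Local Open Scope classical_set_scope.
Context d (Omega : measurableType d).

Lemma measurable_finite_valued (F : finType) (r : Omega -> F) (Q : pred F) :
  (forall f, measurable [set w | r w = f]) -> measurable [set w | Q (r w)].
Proof.
move=> mr; have -> : [set w | Q (r w)] = \bigcup_(f in [set` Q]) [set w | r w = f].
  by apply/seteqP; split=> [w Qw|w [f Qf /= ->]//]; exists (r w).
by apply: fin_bigcup_measurable => //; exact: finite_finset.
Qed.

Lemma measurable_bool_family (I : finType) (b : I -> Omega -> bool)
    (Q : pred {ffun I -> bool}) :
  (forall i, measurable [set w | b i w]) ->
  measurable [set w | Q [ffun i => b i w]].
Proof.
move=> mb; apply: measurable_finite_valued => f.
have -> : [set w | [ffun i => b i w] = f] =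
    \bigcap_(i in [set: I]) [set w | b i w = f i].
  apply/seteqP; split=> [w /= <- i _ /=|w /= h]; first by rewrite ffunE.
  by apply/ffunP => i; rewrite ffunE h.
apply: fin_bigcap_measurable; first exact: finite_finset.
move=> i _; case: (f i); first exact: mb.
rewrite (_ : [set _ | _] = ~` [set w | b i w]); first exact/measurableC/mb.
by apply/seteqP; split=> w /=; case: (b i w).
Qed.

(** The rank vector is a function of the finitely many comparisons
[X i w < X j w], each of which is an event. *)
Lemma measurable_rank (R : realType) n (X : 'I_n -> Omega -> R)
    (Q : pred {ffun 'I_n -> 'I_n}) :
  (forall i, measurable_fun setT (X i)) ->
  measurable [set w | Q (rank (fun i => X i w))].
Proof.
move=> mX; apply: measurable_finite_valued => f.
pose b (ij : 'I_n * 'I_n) w := X ij.1 w < X ij.2 w.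
pose Qf (c : {ffun 'I_n * 'I_n -> bool}) :=
  [forall i, #|[set j | c (j, i)]%SET| == f i].
have -> : [set w | rank (fun i => X i w) = f] = [set w | Qf [ffun ij => b ij w]].
  apply/seteqP; split=> w /=.
    move=> e; rewrite /Qf -e; apply/forallP => i.
    rewrite [X in _ == nat_of_ord X]ffunE /=; apply/eqP.
    by apply: eq_card => j; rewrite !inE ffunE.
  move=> /forallP h; apply/ffunP => i; apply/val_inj; rewrite ffunE /= -(eqP (h i)).
  by apply: eq_card => j; rewrite !inE ffunE.
apply: measurable_bool_family => ij.
rewrite -[X in measurable X]setTI.
by have := measurable_fun_ltr (mX ij.1) (mX ij.2) measurableT (Y := [set true]); apply.
Qed.

Lemma probability_finite_valued (R : realType) (P : probability Omega R)
    (F : finType) (r : Omega -> F) (Q : pred F) :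
  (forall f, measurable [set w | r w = f]) ->
  fine (P [set w | Q (r w)]) = \sum_(f | Q f) fine (P [set w | r w = f]).
Proof.
move=> mr; have -> : [set w | Q (r w)] = \bigcup_(f in [set` Q]) [set w | r w = f].
  by apply/seteqP; split=> [w Qw|w [f Qf /= ->]//]; exists (r w).
rewrite measure_fin_bigcup; last 3 first.
- exact: finite_finset.
- by move=> f g _ _ [w [/= <- <-]].
- by move=> f _; exact: mr.
rewrite -(bigfs _ (r := index_enum F)) ?index_enum_uniq //; last first.
  by move=> f _; rewrite mem_index_enum.
by rewrite -sum_fine // => f _; exact: fin_num_measure.
Qed.
End FiniteValued.

(** * Absence of ties *)

Section Ties.
Local Open Scope classical_set_scope.
Context d (Omega : measurableType d) (R : realType) (P : probability Omega R).

(** For [y < x] the mass at [x] is at most [cdf X x - cdf X y], which tends to 0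
as [y] tends to [x] from the left. *)
Lemma continuous_cdf_atomless (X : {RV P >-> R}) x :
  continuous (cdf X) -> P (X @^-1` [set x]) = 0%E.
Proof.
move=> cX; apply/eqP; rewrite eq_le measure_ge0 andbT.
have mpre (B : set R) : measurable B -> measurable (X @^-1` B).
  by move=> mB; exact: measurable_funPTI.
have fincdf y : cdf X y \is a fin_num by apply: fin_num_measure; exact: measurable_itv.
rewrite -(leeD2lE _ _ (fincdf x)) adde0 -leeBrDr; last exact/fin_num_measure/mpre.
have /cvg_at_left_filter : cdf X y @[y --> x] --> cdf X x := cX x.
move=> /cvge_to_le; apply; near=> y.
rewrite leeBrDr; last exact/fin_num_measure/mpre.
have yx : y < x by near: y; exact: nbhs_left_lt.
have XyXx : X @^-1` `]-oo, y]%classic `&` X @^-1` [set x] = set0.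
  rewrite -preimage_setI (_ : _ `&` _ = set0) ?preimage_set0 //.
  apply/seteqP; split => z //= [] /[swap] ->.
  by rewrite in_itv /= leNgt yx.
have my : measurable (X @^-1` `]-oo, y]%classic) by apply: mpre; exact: measurable_itv.
have mx : measurable (X @^-1` `]-oo, x]%classic) by apply: mpre; exact: measurable_itv.
have m1 : measurable (X @^-1` [set x]) by exact: mpre.
rewrite /cdf /distribution /pushforward -measureU //.
apply: le_measure; rewrite ?inE //; first exact: measurableU.
move=> w [|] /=; rewrite !in_itv /=; last by move=> ->.
move=> /le_trans; apply; exact: ltW.
Unshelve. all: by end_near. Qed.

(** The joint law of [X] and [Y] is the product of their laws, so the mass of
the diagonal is the integral over [x] of the mass that [Y] gives to [x]. *)
Lemma independent_eq0 (X Y : {RV P >-> R}) :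
  (forall A B, measurable A -> measurable B ->
     P (X @^-1` A `&` Y @^-1` B) = (P (X @^-1` A) * P (Y @^-1` B))%E) ->
  (forall x, P (Y @^-1` [set x]) = 0%E) ->
  P [set w | X w = Y w] = 0%E.
Proof.
move=> ind atom.
have mXY : measurable_fun setT (fun w => (X w, Y w)) by exact: measurable_fun_pair.
pose XY : {RV P >-> (R * R)%type} := HB.pack (fun w => (X w, Y w))
  (isMeasurableFun.Build _ _ _ _ _ mXY).
have mD : measurable [set xy : R * R | xy.1 = xy.2].
  rewrite (_ : [set _ | _] = setT `&` (fun xy => xy.1 == xy.2) @^-1` [set true]).
    exact: measurable_fun_eqr measurable_fst measurable_snd measurableT _ _.
  by apply/seteqP; split=> -[x y] /= => [->|[_ /eqP]] //; rewrite eqxx.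
have -> : P [set w | X w = Y w] = distribution P XY [set xy | xy.1 = xy.2] by [].
rewrite -(@product_measure_unique _ _ _ _ _ (distribution P X) (distribution P Y)) //.
apply: integral0_eq => x _ /=.
rewrite (_ : xsection _ _ = [set x]); first exact: atom.
by apply/seteqP; split=> y; rewrite /xsection /= inE /=.
Qed.
End Ties.

(** * Joint laws determined by boxes *)

Section SameLaw.
Local Open Scope classical_set_scope.
Context d (Omega : measurableType d) (R : realType) (P : probability Omega R).
Variable n : nat.

Definition box (B : 'I_n -> set R) : set ('I_n -> R) :=
  [set x | forall i, B i (x i)].

Definition boxes : set (set ('I_n -> R)) :=
  [set box B | B in [set B | forall i, measurable (B i)]].

(* The product sigma-algebra on vectors of reals. *)
Local Notation vectors := (g_sigma_algebraType boxes).

Lemma measurable_box (B : 'I_n -> set R) :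
  (forall i, measurable (B i)) -> measurable (box B : set vectors).
Proof. by move=> mB; apply: sub_sigma_algebra; exists B. Qed.

Lemma measurable_coordinate i :
  measurable_fun setT (fun x : vectors => x i : R).
Proof.
move=> _ B mB; rewrite setTI.
rewrite (_ : _ @^-1` _ = box (fun j => if j == i then B else setT)).
  by apply: measurable_box => j; case: ifP.
apply/seteqP; split=> x /=; first by move=> xB j; case: eqP => [->|].
by move=> /(_ i); rewrite eqxx.
Qed.

Lemma measurable_vector (X : 'I_n -> Omega -> R) :
  (forall i, measurable_fun setT (X i)) ->
  measurable_fun setT (fun w => (fun i => X i w) : vectors).
Proof.
move=> mX; apply: (measurability (rT := vectors) boxes) => // _ [_ [B mB <-] <-].
rewrite (_ : _ `&` _ = \bigcap_(i in [set: 'I_n]) (X i @^-1` B i)).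
  apply: fin_bigcap_measurable => [|i _]; first exact: finite_finset.
  by rewrite -[X in measurable X]setTI; apply: mX.
by apply/seteqP; split=> [w [_ h] i _|w h]; [exact: h|split=> // i; exact: h].
Qed.

(** Boxes form a pi-system, and the sets on which two probabilities agree are
closed under complement and countable disjoint union. *)
Lemma same_law (X Y : 'I_n -> Omega -> R) :
  (forall i, measurable_fun setT (X i)) ->
  (forall i, measurable_fun setT (Y i)) ->
  (forall B : 'I_n -> set R, (forall i, measurable (B i)) ->
     P [set w | forall i, B i (X i w)] = P [set w | forall i, B i (Y i w)]) ->
  forall S : set vectors, measurable S ->
  P [set w | S (fun i => X i w)] = P [set w | S (fun i => Y i w)].
Proof.
move=> mX mY XY.
pose pre (Z : 'I_n -> Omega -> R) (S : set vectors) := [set w | S (fun i => Z i w)].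
have mpre Z S : (forall i, measurable_fun setT (Z i)) -> measurable S ->
    measurable (pre Z S).
  move=> mZ mS; rewrite -[X in measurable X]setTI; exact: (measurable_vector mZ).
apply: (@dynkin_induction _ vectors boxes) => //.
- move=> _ _ [A mA <-] [B mB <-]; exists (fun i => A i `&` B i).
    by move=> i; exact: measurableI.
  apply/seteqP; split=> x; first by move=> h; split=> i; have [] := h i.
  by move=> [hA hB] i; split.
- by move=> _ [B mB <-]; exact: XY.
- move=> S mS XYS.
  have preC Z : [set w | (~` S) (fun i => Z i w)] = ~` pre Z S by [].
  by rewrite !preC !probability_setC ?XYS //; exact: mpre.
- move=> F mF tF XYF.
  have preU Z : [set w | (\bigcup_k F k) (fun i => Z i w)] = \bigcup_k pre Z (F k).
    by [].
  have tpre Z : trivIset setT (fun k => pre Z (F k)).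
    move=> i j _ _ [w [Fi Fj]]; apply: tF => //; by exists (fun i => Z i w).
  rewrite !preU !measure_bigcup //; [|by move=> k _; exact: mpre..].
  by apply: eq_eseriesr => k _; exact: XYF.
Qed.
End SameLaw.

(** * The tail signature *)

Section RankLawLifetimes.
Local Open Scope classical_set_scope.
Context d (Omega : measurableType d) (R : realType) (P : probability Omega R).
Variables (n : nat) (T : 'I_n -> {RV P >-> R}).
Hypothesis hT : continuous_iid T.

Local Notation lifetimes w := (fun i => T i w).

Definition rank_law (f : {ffun 'I_n -> 'I_n}) : R :=
  fine (P [set w | rank (lifetimes w) = f]).

Lemma mlifetime i : measurable_fun setT (T i).
Proof. exact: measurable_funPT. Qed.

Lemma measurable_rank_eq f : measurable [set w | rank (lifetimes w) = f].
Proof.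
have := measurable_rank (pred1 f) mlifetime.
by congr measurable; apply/seteqP; split=> w /= /eqP.
Qed.

Lemma probability_rank (Q : pred {ffun 'I_n -> 'I_n}) :
  fine (P [set w | Q (rank (lifetimes w))]) = \sum_(f | Q f) rank_law f.
Proof. exact: probability_finite_valued measurable_rank_eq. Qed.

Lemma rank_law_sum1 : \sum_f rank_law f = 1.
Proof.
rewrite -(probability_rank xpredT) (_ : [set _ | _] = setT) ?probability_setT //.
by apply/seteqP; split.
Qed.

(** Equal ranks force equal lifetimes, and two independent lifetimes without
atoms are almost surely different. *)
Lemma rank_law_noninj (f : {ffun 'I_n -> 'I_n}) :
  ~~ injectiveb f -> rank_law f = 0.
Proof.
move=> /injectivePn[i [j ij fij]]; case: hT => ind _ cont.
have tie0 : P [set w | T i w = T j w] = 0%E.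
  apply: independent_eq0 => [A B mA mB|x]; last exact/continuous_cdf_atomless/cont.
  pose C k := if k == i then A else B.
  have := ind [set i; j]%SET C; rewrite big_setU1 ?inE //= big_set1 /C eqxx.
  rewrite (negPf (_ : j != i)) 1?eq_sym // => <-.
    congr (P _); apply/seteqP; split=> w /=.
      move=> [Ai Bj] k; rewrite !inE => /orP[] /eqP ->; rewrite ?eqxx //.
      by rewrite eq_sym (negPf ij).
    move=> h; split; first by have := h i; rewrite !inE eqxx; exact.
    by have := h j; rewrite !inE eqxx orbT eq_sym (negPf ij); exact.
  by move=> k; case: ifP.
rewrite /rank_law (_ : P _ = 0%E) //.
apply/eqP; rewrite eq_le measure_ge0 andbT -tie0; apply: le_measure; rewrite ?inE.
- exact: measurable_rank_eq.
- rewrite (_ : [set _ | _] = setT `&` (fun w => T i w == T j w) @^-1` [set true]).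
    exact: measurable_fun_eqr (mlifetime i) (mlifetime j) measurableT _ _.
  by apply/seteqP; split=> w /= => [->|[_ /eqP]] //; rewrite eqxx.
move=> w /= rf; apply/eqP; rewrite eq_le -!(leq_rank (lifetimes w)) rf fij.
by rewrite leqnn.
Qed.

(** The permuted lifetimes give every box the same probability as the original
ones, namely the product of the marginal ones, so the two families have the same
joint law; and permuting the lifetimes permutes their ranks ([rank_perm]). *)
Lemma rank_law_exch (f : {ffun 'I_n -> 'I_n}) (s : 'S_n) :
  rank_law [ffun i => f (s i)] = rank_law f.
Proof.
case: hT => ind idd _.
have boxE (B : 'I_n -> set R) (u : 'S_n) : (forall i, measurable (B i)) ->
    P [set w | forall i, B i (T (u i) w)] = (\prod_i P (T i @^-1` B i))%E.
  move=> mB; have := ind [set: 'I_n]%SET (fun i => B ((u^-1)%g i)) (fun i => mB _).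
  rewrite (_ : [set w | _] = [set w | forall i, B i (T (u i) w)]).
    move=> ->; under eq_bigl do rewrite inE.
    rewrite (reindex_inj (@perm_inj _ u)); apply: eq_bigr => i _.
    by rewrite permK; exact: idd.
  apply/seteqP; split=> w h i; first by have := h (u i); rewrite inE permK; exact.
  by have := h ((u^-1)%g i); rewrite permKV.
pose S : set (g_sigma_algebraType (@boxes R n)) := [set x | rank x = f].
have mS : measurable S.
  have := measurable_rank (pred1 f) (@measurable_coordinate R n).
  by congr measurable; apply/seteqP; split=> w /= /eqP.
rewrite /rank_law; congr fine.
transitivity (P [set w | S (fun i => T ((s^-1)%g i) w)]).
  congr (P _); apply/seteqP; split=> w /=; rewrite /S /=.
    move=> e; rewrite (rank_perm (lifetimes w) (s^-1)%g) e.
    by apply/ffunP => i; rewrite !ffunE permKV.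
  rewrite (rank_perm (lifetimes w) (s^-1)%g) => <-.
  by apply/ffunP => i; rewrite !ffunE permK.
apply: (same_law (Y := fun i => T i)) mS => [i|i|B mB].
- exact: mlifetime.
- exact: mlifetime.
have := boxE B 1%g mB; under eq_set => w do under eq_forall do rewrite perm1.
by move=> ->; exact: boxE.
Qed.

(** The probability of failing at the [m]-th failure is [up m.-1 - up m], where
[up m] is the probability that the components surviving the first [m] failures
form a working set.  The tail sums telescope, and [up n = 0] since no component
survives [n] failures. *)
Lemma tail_signature_size_average phi k : semicoherent phi -> (k <= n)%N ->
  tail_signature T phi k = size_average R phi (n - k).
Proof.
move=> hphi kn.
pose up m := \sum_f rank_law f * (phi (setvec (upper_set f m)))%:R.
have upE m : (m <= n)%N -> up m = size_average R phi (n - m).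
  exact: (sum_rank_law_upper_set rank_law_sum1 rank_law_noninj rank_law_exch).
have sig m : (1 <= m <= n)%N -> signature T phi m = up m.-1 - up m.
  move=> mn; rewrite /signature.
  rewrite (_ : [set _ | _] = [set w | failure_at phi (rank (lifetimes w)) m]).
    rewrite (probability_rank (fun f => failure_at phi f m)) big_mkcond -sumrB.
    apply: eq_bigr => f _.
    have [/injectiveP fi|/rank_law_noninj ->] := boolP (injectiveb f); last first.
      by rewrite !mul0r subr0; case: ifP.
    rewrite failure_at_inj // -mulrBr.
    have sub : upper_set f m \subset upper_set f m.-1.
      by apply/fintype.subsetP => i; rewrite !inE; apply: leq_trans; exact: leq_pred.
    have := semicoherent_mono hphi sub.
    case: (phi (setvec (upper_set f m))) => /=;
      case: (phi (setvec (upper_set f m.-1))) => //=.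
    - by rewrite subrr mulr0.
    - by rewrite subr0 mulr1.
    - by rewrite subrr mulr0.
  by apply/seteqP; split=> w /=; rewrite (failure_atP hphi).
have upn : up n = 0.
  rewrite /up big1 // => f _; rewrite (_ : setvec _ = [ffun=> false]).
    by case: hphi => _ -> _; rewrite mulr0.
  by apply/ffunP => i; rewrite !ffunE inE leqNgt ltn_ord.
rewrite -upE // -[RHS]subr0 -upn -opprB -(telescope_sumr up kn) /tail_signature.
rewrite big_add1 /= -sumrN; apply: eq_big_nat => i /andP[ki lin].
by rewrite sig ?opprB.
Qed.
End RankLawLifetimes.

Theorem proposition2 (d : measure_display) (Omega : measurableType d)
    (R : realType) (P : probability Omega R) (n : nat) (hn : (1 <= n)%N)
    (phi : {ffun 'I_n -> bool} -> bool) (hphi : semicoherent phi)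
    (T : 'I_n -> {RV P >-> R}) (hT : continuous_iid T) :
  (forall k : nat, (k <= n)%N ->
     tail_signature T phi k =
       \sum_(0 <= j < (n - k).+1)
          ('C(n - j, k)%:R / 'C(n, k)%:R) * domination R phi j
     /\
     \sum_(0 <= j < (n - k).+1)
        ('C(n - j, k)%:R / 'C(n, k)%:R) * domination R phi j =
       \sum_(0 <= j < (n - k).+1)
          ('C(n - k, j)%:R / 'C(n, j)%:R) * domination R phi j)
  /\
  (forall k : nat, (k <= n)%N ->
     domination R phi k =
       'C(n, k)%:R *
         \sum_(0 <= j < k.+1)
            (-1) ^+ (k - j) * 'C(k, j)%:R * tail_signature T phi (n - j)).
Proof.
split=> k kn.
  have swap : \sum_(0 <= j < (n - k).+1)
      ('C(n - j, k)%:R / 'C(n, k)%:R) * domination R phi j =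
    \sum_(0 <= j < (n - k).+1)
      ('C(n - k, j)%:R / 'C(n, j)%:R) * domination R phi j.
    by apply: eq_big_nat => j /andP[_ jn]; rewrite bin_ratio_swap.
  split=> //; rewrite swap tail_signature_size_average //.
  by rewrite size_average_domination // leq_subr.
rewrite domination_size_average //; congr (_ * _); apply: eq_big_nat => j /andP[_ jk].
have jn : (j <= n)%N by rewrite (leq_trans _ kn).
by rewrite tail_signature_size_average ?leq_subr // subKn.
Qed.
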